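(* Let $b\ge \tfrac32$, $N=R(b)$ and $\epsilon=F(b)$. For $(x,\gamma)\in[0,1)^2$, one has $(Z_{1/b}Q_2)(x,\gamma)=0$ only if $x\in[|\epsilon|,1-|\epsilon|]$, and moreover only if either (i) $\gamma=k/N$ for some integer $k\not\equiv 0\pmod N$, in which case $(Z_{1/b}Q_2)(y,k/N)=0$ for every $y\in[|\epsilon|,1-|\epsilon|]$; or (ii) $\gamma$ satisfies $$\tfrac12\cot(\pi\gamma)+(b-N)\cot(N\pi\gamma)=0$$ (an equation understood for those $\gamma$ at which both cotangents are defined, i.e. $N\gamma\notin\mathbb Z$), in which case $x=\tfrac12$ is the unique zero of $(Z_{1/b}Q_2)(\cdot,\gamma)$ in $[0,1)$.
   Context: For $x\in\mathbb R$, $R(x)=\lfloor x+\tfrac12\rfloor$ and $F(x)=x-R(x)\in[-\tfrac12,\tfrac12)$. The second-order B-spline is $Q_2=Q_1*Q_1$ with $Q_1=\chi_{[-1/2,1/2]}$, i.e. $Q_2(x)=\max(0,1-|x|)$. The Zak transform with parameter $\lambda>0$ is $(Z_\lambda f)(x,\gamma)=\sqrt\lambda\sum_{k\in\mathbb Z} f(\lambda(x-k))\,e^{2\pi i k\gamma}$; for $f=Q_2$ the sum is finite and $Z_\lambda Q_2$ is defined pointwise for all $(x,\gamma)\in\mathbb R^2$. *)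

(* Defs.v *)
From HB Require Import structures.
From mathcomp Require Import all_boot all_order all_algebra.
From mathcomp Require Import all_classical all_reals all_analysis.
From mathcomp Require Import complex lra.
Set Implicit Arguments.
Unset Strict Implicit.
Unset Printing Implicit Defensive.
Import Order.TTheory GRing.Theory Num.Theory.
Import numFieldNormedType.Exports.
Local Open Scope classical_set_scope.
Local Open Scope ring_scope.

Definition nround (R : realType) (x : R) : int := Num.floor (x + 2^-1).

Definition fround (R : realType) (x : R) : R := x - (nround x)%:~R.

Definition cot (R : realType) (t : R) : R := cos t / sin t.

Definition expi (R : realType) (t : R) : R[i] := Complex (cos t) (sin t).

Definition convolution (R : realType) (f g : R -> R) (x : R) : R :=
  \int[lebesgue_measure]_t (f t * g (x - t)).

Definition Q1 (R : realType) : R -> R := \1_(`[- 2^-1, 2^-1] : set R).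

Definition Q2 (R : realType) : R -> R := convolution (@Q1 R) (@Q1 R).

(* [\sum_(k \in [set: int])] is the sum of a finitely supported family (it is
   0 by convention for infinitely many nonzero terms), so this is the pointwise
   Zak transform of f as soon as f has bounded support; for Q2 see
   [zak_Q2_finite_support]. *)
Definition zak (R : realType) (lam : R) (f : R -> R[i]) (x gam : R) : R[i] :=
  (Num.sqrt lam)%:C%C *
    \sum_(k \in [set: int])
       (f (lam * (x - k%:~R)) * expi (2 * pi * k%:~R * gam)).

Definition zakQ2 (R : realType) (lam : R) : R -> R -> R[i] :=
  zak lam (fun t => (Q2 t)%:C%C).

Lemma Q2E (R : realType) (x : R) : Q2 x = Num.max 0 (1 - `|x|).
Proof.
rewrite /Q2 /convolution /Rintegral.
pose a : R := Num.max (- 2^-1) (x - 2^-1).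
pose c : R := Num.min (2^-1) (x + 2^-1).
have -> : (fun t : R => (Q1 t * Q1 (x - t))%:E) =
          (fun t : R => (\1_(`[a, c] : set R) t)%:E).
  apply/funext => t; congr (_%:E).
  rewrite /Q1 !indicE -natrM mulnb; congr (_%:R); congr nat_of_bool.
  rewrite !mem_setE !in_itv /= /a /c ge_max le_min.
  apply/idP/idP => [/andP[/andP[? ?] /andP[? ?]]|/andP[/andP[? ?] /andP[? ?]]];
    apply/andP; split; apply/andP; split; lra.
rewrite integral_indic //= setIT lebesgue_measure_itv /= lte_fin.
have -> : 1 - `|x| = c - a.
  rewrite /a /c /Num.max /Num.min; case: ifP => ?; case: ifP => ?;
  case: (ger0P x) => ?; lra.
case: ltP => h /=; [rewrite max_r | rewrite max_l]; lra.
Qed.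

Lemma zak_Q2_finite_support (R : realType) (lam x gam : R) : 0 < lam ->
  finite_set [set k : int | (Q2 (lam * (x - k%:~R)))%:C%C
                            * expi (2 * pi * k%:~R * gam) != 0].
Proof.
move=> lam0.
pose M := (Num.truncn (`|x| + lam^-1)).+1.
apply: (@sub_finite_set _ _ ((fun n : nat => n%:Z) @` `I_M
                             `|` (fun n : nat => - n%:Z) @` `I_M)); last first.
  by rewrite finite_setU; split; apply: finite_image; exact: finite_II.
move=> k /= hk.
have hQ : Q2 (lam * (x - k%:~R)) != 0.
  by apply: contraNneq hk => ->; rewrite mul0r.
have hlt : `|x - k%:~R| < lam^-1.
  rewrite ltNge; apply: contraNN hQ => hle.
  rewrite Q2E max_l // subr_le0 normrM (gtr0_norm lam0).
  by rewrite -ler_pdivrMl // mulr1.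
have hkM : (`|k|%N < M)%N.
  rewrite -(ltr_nat R) natr_absz intr_norm.
  apply: lt_trans (truncnS_gt _).
  have : `|k%:~R : R| <= `|x| + `|x - k%:~R|.
    rewrite [leLHS](_ : _ = `|x - (x - k%:~R)|) ?ler_normB //.
    by rewrite opprB addrC subrK.
  lra.
case: (ger0P k) => k0; [left|right]; exists `|k|%N => //.
- by rewrite gez0_abs.
- by rewrite ltz0_abs // opprK.
Qed.

(* Main.v *)
Require Import Defs.
From HB Require Import structures.
From mathcomp Require Import all_boot all_order all_algebra.
From mathcomp Require Import all_classical all_reals all_analysis.
From mathcomp Require Import complex.
From mathcomp Require Import ring lra zify.
Import Order.TTheory GRing.Theory Num.Theory.
Local Open Scope ring_scope.

(** Write t = pi * gam, q y = max 0 (b - |y|) and w = exp (2 i t).  Up to the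
    nonzero factor b^(-3/2), the Zak transform of Q2 at (x, gam) is the finite
    sum of the q (x - k) w^k.  The idea is to pull out the phase exp (i t):
    pairing k = j + 1 with k = - j then gives conjugate exponentials, and the
    sum becomes exp (i t) (re + i im) with the real sums
      re = sum_j (q (x - j - 1) + q (x + j)) cos ((2 j + 1) t),
      im = sum_j (q (x - j - 1) - q (x + j)) sin ((2 j + 1) t)
    ([zakQ2E]); the transform vanishes iff re = im = 0 ([zakQ2_eq0]).

    Let N be the integer nearest to b and eps = b - N.  For x in
    [|eps|, 1 - |eps|] only the indices j < N contribute, each on a linear
    branch of q, so the two weights are 2 b - 2 j - 1, which does not depend
    on x, and 2 x - 1, which does not depend on j.  The closed forms
    [sum_cos_odd] and [sum_sin_odd] give
      (sin t)^2 re = sin (N t) (2 eps cos (N t) sin t + sin (N t) cos t),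
      sin t im = (2 x - 1) (sin (N t))^2.
    Both vanish iff sin (N t) = 0, which is case (i), or x = 1/2 and the
    bracket is 0, which after division by 2 sin t sin (N t) is the cotangent
    equation of case (ii); see [zak_inner_eq0].

    Outside this interval there is no zero.  The symmetry x -> 1 - x only
    conjugates re + i im, so let x < |eps|.  With m = floor b and e = b - m, one
    has |eps| = min (e, 1 - e), and the indices k from - m to m contribute.
    Undoing the phase, the real and imaginary parts of the sum, multiplied by
    (sin t)^2 and by sin t, are
      (1 - e) (sin (m t))^2 + e (sin ((m + 1) t))^2 - x (sin t)^2,
      2 x sin (m t) sin ((m + 1) t):
    the first is an interpolation of two Fejer kernels, lowered by x.  If the
    second one is 0 then x = 0, sin (m t) = 0 or sin ((m + 1) t) = 0, and the
    first one is positive, or equal to (e - x) (sin t)^2, or to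
    (1 - e - x) (sin t)^2; all are nonzero ([zak_outer_neq0]).  At gam = 0,
    where sin t = 0, the sum is plainly positive. *)

(** * Reduction to real trigonometric sums *)

Definition tent {R : realType} (b y : R) : R := Num.max 0 (b - `|y|).

(** The real part, after removal of the phase, of the terms of index k with
    - n < k <= n. *)
Definition zak_re {R : realType} (n : nat) (b x t : R) : R :=
  \sum_(j < n)
    (tent b (x - j.+1%:R) + tent b (x + j%:R)) * cos (j.*2.+1%:R * t).

Definition zak_im {R : realType} (n : nat) (b x t : R) : R :=
  \sum_(j < n)
    (tent b (x - j.+1%:R) - tent b (x + j%:R)) * sin (j.*2.+1%:R * t).

(** Positive indices are paired with nonpositive ones so that the phase
    exp (i t), the geometric mean of w^(j + 1) and w^(- j), can be factored
    out of each pair. *)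
Lemma fsbig_int_support (V : nmodType) (n : nat) (g : int -> V) :
  (forall k : int, (k <= - n%:Z) || (n%:Z < k) -> g k = 0) ->
  \sum_(k \in [set: int]) g k = \sum_(j < n) (g j.+1%:Z + g (- j%:Z)).
Proof.
move=> g0.
pose r := [seq j.+1%:Z | j <- iota 0 n] ++ [seq - j%:Z | j <- iota 0 n].
rewrite (@fsbigE _ _ _ _ _ r) //=; last 2 first.
- rewrite cat_uniq !map_inj_uniq ?iota_uniq /= ?andbT; last 2 first.
  + by move=> i j /eqP; rewrite eqr_opp => /eqP[].
  + by move=> i j [].
  apply/hasPn => _ /mapP[j _ ->]; apply/negP => /mapP[i _]; lia.
- move=> k _ kr; apply: g0; apply/negPn/negP => hk; move/negP: kr; apply.
  rewrite mem_cat; case: (lerP k 0) => k0; apply/orP; [right|left].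
  + by apply/mapP; exists `|k|%N; rewrite ?mem_iota; lia.
  + by apply/mapP; exists `|k|.-1%N; rewrite ?mem_iota; lia.
rewrite (eq_bigl xpredT); last by move=> k; rewrite in_setT.
rewrite /r big_cat !big_map /= -big_split /=.
rewrite -[in RHS](big_mkord xpredT (fun j => g j.+1%:Z + g (- j%:Z))).
by rewrite /index_iota subn0.
Qed.

Lemma Complex_sum {R : realType} (n : nat) (f g : 'I_n -> R) :
  \sum_(j < n) Complex (f j) (g j) =
  Complex (\sum_(j < n) f j) (\sum_(j < n) g j).
Proof.
elim: n f g => [|n IH] f g; first by rewrite !big_ord0.
by rewrite !big_ord_recr /= IH.
Qed.

Lemma expiD {R : realType} (s t : R) : expi (s + t) = expi s * expi t.
Proof. by rewrite /expi cosD sinD; simpc; rewrite [sin s * _ + _]addrC. Qed.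

Lemma expi_neq0 {R : realType} (t : R) : expi t != 0.
Proof.
rewrite eq_complex /=; apply/negP => /andP[/eqP c0 /eqP s0].
by have := cos2Dsin2 t; rewrite c0 s0; lra.
Qed.

Lemma tent0 {R : realType} (b y : R) : b <= `|y| -> tent b y = 0.
Proof. by move=> h; rewrite /tent max_l // subr_le0. Qed.

Lemma tentE {R : realType} (b y : R) : `|y| <= b -> tent b y = b - `|y|.
Proof. by move=> h; rewrite /tent max_r // subr_ge0. Qed.

Lemma tentN {R : realType} (b y : R) : tent b (- y) = tent b y.
Proof. by rewrite /tent normrN. Qed.

Lemma tent_ge0 {R : realType} (b y : R) : 0 <= tent b y.
Proof. by rewrite /tent le_max lexx. Qed.

Lemma Q2_tent {R : realType} (b y : R) : 0 < b ->
  Q2 (b^-1 * y) = b^-1 * tent b y.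
Proof.
move=> b0; rewrite Q2E /tent maxr_pMr ?invr_ge0 ?ltW // mulr0.
by rewrite normrM gtr0_norm ?invr_gt0 // mulrBr mulVf ?gt_eqF.
Qed.

(** The two bounds on n say that the support ]x - b, x + b[ of the tents meets
    only the integers k with - n < k <= n. *)
Lemma zakQ2E {R : realType} (n : nat) (b x gam : R) :
  0 < b -> b - x <= n%:R -> b + x <= n.+1%:R ->
  zakQ2 b^-1 x gam =
  (Num.sqrt b^-1 * b^-1)%:C%C *
    (expi (pi * gam) *
     Complex (zak_re n b x (pi * gam)) (zak_im n b x (pi * gam))).
Proof.
move=> b0 hl hr; rewrite /zakQ2 /zak (fsbig_int_support _ n); last first.
  move=> k hk; rewrite Q2_tent // tent0 ?mulr0 ?mul0r //.
  case/orP: hk => hk.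
  - have : (k%:~R : R) <= (- n%:Z)%:~R by rewrite ler_int.
    rewrite mulrNz -pmulrn => hk'.
    by have := ler_norm (x - k%:~R); lra.
  - have : ((n.+1)%:Z%:~R : R) <= k%:~R by rewrite ler_int; lia.
    rewrite -pmulrn => hk'.
    by have := ler_norm (- (x - k%:~R)); rewrite normrN; lra.
rewrite rmorphM -mulrA; congr (_ * _).
rewrite /zak_re /zak_im -Complex_sum !mulr_sumr; apply: eq_bigr => j _.
rewrite !Q2_tent // !rmorphM -!mulrA -mulrDr; congr (_ * _).
set t := pi * gam; set m := j.*2.+1%:R * t.
have mE : m = 2 * j%:R * t + t.
  by rewrite /m -addn1 -muln2 natrD natrM; ring.
have -> : 2 * (pi * (j.+1%:Z%:~R * gam)) = t + m.
  by rewrite mE -pmulrn -(addn1 j) natrD /t; ring.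
have -> : 2 * (pi * ((- j%:Z)%:~R * gam)) = t + (- m).
  by rewrite mE mulrNz -pmulrn /t; ring.
rewrite !expiD mulrCA [X in _ + X]mulrCA -mulrDr; congr (_ * _).
rewrite /expi cosN sinN mulrNz opprK -!pmulrn.
by simpc; rewrite mulrDl mulrBl.
Qed.

Lemma zakQ2_eq0 {R : realType} (n : nat) (b x gam : R) :
  0 < b -> b - x <= n%:R -> b + x <= n.+1%:R ->
  zakQ2 b^-1 x gam = 0 <->
  zak_re n b x (pi * gam) = 0 /\ zak_im n b x (pi * gam) = 0.
Proof.
move=> b0 hl hr; rewrite (zakQ2E n) //; split => [/eqP|[-> ->]]; last first.
  by rewrite -[Complex 0 0]/(0 : R[i]) !mulr0.
rewrite !mulf_eq0 (negPf (expi_neq0 _)) /= => /orP[/eqP[] /eqP|/eqP[]//].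
by rewrite mulf_eq0 sqrtr_eq0 invr_eq0 invr_le0 lt_geF ?gt_eqF.
Qed.

(** Reflection of x about 1/2 exchanges the tents at j + 1 and - j, because the
    tent is even: it conjugates the sum. *)
Lemma zak_re_reflect {R : realType} n (b x t : R) :
  zak_re n b (1 - x) t = zak_re n b x t.
Proof.
apply: eq_bigr => j _; congr (_ * _); rewrite addrC; congr (_ + _).
- by rewrite -tentN; congr (tent _); rewrite -addn1 natrD; ring.
- by rewrite -tentN; congr (tent _); rewrite -addn1 natrD; ring.
Qed.

Lemma zak_im_reflect {R : realType} n (b x t : R) :
  zak_im n b (1 - x) t = - zak_im n b x t.
Proof.
rewrite -sumrN; apply: eq_bigr => j _; rewrite -mulNr opprB; congr (_ * _).
congr (_ - _); rewrite -tentN; congr (tent _); rewrite -addn1 natrD; ring.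
Qed.

Lemma zak_re_gt0_at0 {R : realType} n (b x : R) :
  (0 < n)%N -> `|x| < b -> 0 < zak_re n b x 0.
Proof.
case: n => // n _ xb; rewrite /zak_re big_ord_recl /= !mulr0 cos0 mulr1.
rewrite addr0 (tentE b x) ?ltW //.
apply: ltr_wpDr; last by have := tent_ge0 b (x - 1); lra.
by apply: sumr_ge0 => j _; rewrite mulr0 cos0 mulr1 addr_ge0 ?tent_ge0.
Qed.

(** * Closed forms of the trigonometric sums *)

Lemma cos_odd_mul {R : realType} j (t : R) :
  cos (j.*2.+1%:R * t) = (cos (j%:R * t) ^+ 2 - sin (j%:R * t) ^+ 2) * cos t
     - 2 * sin (j%:R * t) * cos (j%:R * t) * sin t.
Proof.
have -> : j.*2.+1%:R * t = j%:R * t + j%:R * t + t.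
  by rewrite -addn1 -addnn !natrD; ring.
by rewrite !cosD !sinD; ring.
Qed.

Lemma sin_odd_mul {R : realType} j (t : R) :
  sin (j.*2.+1%:R * t) = (cos (j%:R * t) ^+ 2 - sin (j%:R * t) ^+ 2) * sin t
     + 2 * sin (j%:R * t) * cos (j%:R * t) * cos t.
Proof.
have -> : j.*2.+1%:R * t = j%:R * t + j%:R * t + t.
  by rewrite -addn1 -addnn !natrD; ring.
by rewrite !sinD !cosD; ring.
Qed.

Lemma natrS_mul {R : realType} j (t : R) : j.+1%:R * t = j%:R * t + t.
Proof. by rewrite -addn1 natrD mulrDl mul1r. Qed.

(** This and [sum_cos_odd] are multiplied by powers of sin t so as to hold for
    every t; each induction step is a polynomial identity modulo
    cos t ^ 2 + sin t ^ 2 = 1. *)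
Lemma sum_sin_odd {R : realType} n (t : R) :
  sin t * \sum_(j < n) sin (j.*2.+1%:R * t) = sin (n%:R * t) ^+ 2.
Proof.
elim: n => [|n IH]; first by rewrite big_ord0 mul0r sin0 mulr0 expr0n.
rewrite big_ord_recr /= mulrDr IH sin_odd_mul (natrS_mul n) sinD.
have := cos2Dsin2 t.
move: (sin t) (cos t) (sin (n%:R * t)) (cos (n%:R * t)) => s c S C h.
apply/eqP; rewrite -subr_eq0; apply/eqP.
by transitivity (S ^+ 2 * (1 - (c ^+ 2 + s ^+ 2))); [ring | rewrite h; ring].
Qed.

(** The weights are affine in 2 j + 1, and differentiating the sum of sines in
    t multiplies cos ((2 j + 1) t) by 2 j + 1: hence a closed form exists. *)
Lemma sum_cos_odd {R : realType} n (b t : R) :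
  sin t ^+ 2 * \sum_(j < n) (2 * b - j.*2.+1%:R) * cos (j.*2.+1%:R * t) =
  sin (n%:R * t) *
    (2 * (b - n%:R) * cos (n%:R * t) * sin t + sin (n%:R * t) * cos t).
Proof.
elim: n => [|n IH]; first by rewrite big_ord0 mul0r sin0 mulr0 mul0r.
rewrite big_ord_recr /= mulrDr IH cos_odd_mul (natrS_mul n) sinD cosD.
have -> : (n.*2.+1%:R : R) = 2 * n%:R + 1.
  by rewrite -addn1 -addnn !natrD; ring.
rewrite -(addn1 n) natrD.
have := cos2Dsin2 t.
move: (sin t) (cos t) (sin (n%:R * t)) (cos (n%:R * t)) => s c S C h.
move: n%:R => m.
apply/eqP; rewrite -subr_eq0; apply/eqP.
transitivity ((2 * (b - m) * S * C * s + S ^+ 2 * c)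
               * (1 - (c ^+ 2 + s ^+ 2))); first by ring.
by rewrite h; ring.
Qed.

(** * Zeros for x between |eps| and 1 - |eps| *)

Lemma tent_inner {R : realType} (n : nat) (b x : R) (j : nat) :
  0 <= x <= 1 -> n%:R - b <= x <= b - n%:R + 1 -> (j < n)%N ->
  tent b (x - j.+1%:R) = b - j.+1%:R + x /\ tent b (x + j%:R) = b - j%:R - x.
Proof.
move=> /andP[x0 x1] /andP[h1 h2] jn.
have : (j.+1%:R : R) <= n%:R by rewrite ler_nat.
have : (0 : R) <= j%:R by rewrite ler0n.
rewrite -(addn1 j) natrD => j0 hj.
have e1 : `|x - (j%:R + 1)| = j%:R + 1 - x by rewrite ler0_norm; lra.
have e2 : `|x + j%:R| = x + j%:R by rewrite ger0_norm; lra.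
by split; rewrite tentE ?e1 ?e2; lra.
Qed.

Lemma zak_re_inner {R : realType} (n : nat) (b x t : R) :
  0 <= x <= 1 -> n%:R - b <= x <= b - n%:R + 1 ->
  zak_re n b x t = \sum_(j < n) (2 * b - j.*2.+1%:R) * cos (j.*2.+1%:R * t).
Proof.
move=> hx h; apply: eq_bigr => j _; congr (_ * _).
have [-> ->] := tent_inner n b x j hx h (ltn_ord j).
by rewrite -(addn1 j) -(addn1 j.*2) -addnn !natrD; ring.
Qed.

Lemma zak_im_inner {R : realType} (n : nat) (b x t : R) :
  0 <= x <= 1 -> n%:R - b <= x <= b - n%:R + 1 ->
  zak_im n b x t = (2 * x - 1) * \sum_(j < n) sin (j.*2.+1%:R * t).
Proof.
move=> hx h; rewrite mulr_sumr; apply: eq_bigr => j _; congr (_ * _).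
have [-> ->] := tent_inner n b x j hx h (ltn_ord j).
by rewrite -(addn1 j) natrD; ring.
Qed.

(** In this range re does not depend on x, while im is a product of 2 x - 1
    and a sum which does not depend on x; hence a zero either persists for all
    x or sits at 1/2. *)
Lemma zak_inner_eq0 {R : realType} (n : nat) (b x t : R) :
  sin t != 0 -> 0 <= x <= 1 -> n%:R - b <= x <= b - n%:R + 1 ->
  zak_re n b x t = 0 /\ zak_im n b x t = 0 <->
  sin (n%:R * t) = 0 \/
  2 * (b - n%:R) * cos (n%:R * t) * sin t + sin (n%:R * t) * cos t = 0
    /\ x = 2^-1.
Proof.
move=> s0 hx h; rewrite zak_re_inner // zak_im_inner //.
have rE := sum_cos_odd n b t; have iE := sum_sin_odd n t.
set re := \sum_(j < n) _ * _ in rE *; set im := \sum_(j < n) _ in iE *.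
split=> [[re0 /eqP]|].
- rewrite mulf_eq0 => /orP[/eqP x2|/eqP im0].
  + move: rE; rewrite re0 mulr0 => /esym/eqP.
    rewrite mulf_eq0 => /orP[/eqP|/eqP]; first by left.
    by right; split=> //; lra.
  + by left; move: iE; rewrite im0 mulr0 => /esym/eqP; rewrite sqrf_eq0 => /eqP.
- case=> [S0|[e0 ->]].
  + move: rE iE; rewrite S0 mul0r expr0n /= => /eqP + /eqP.
    rewrite !mulf_eq0 !(negPf s0) /= => /eqP -> /eqP ->.
    by rewrite mulr0.
  + move: rE; rewrite e0 mulr0 => /eqP.
    rewrite mulf_eq0 sqrf_eq0 (negPf s0) /= => /eqP ->; split=> //.
    by rewrite divff ?pnatr_eq0 // subrr mul0r.
Qed.

(** * No zero near 0 and 1 *)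

(** Multiplying by exp (i t) again makes the sum symmetric under k -> - k up to
    x; its imaginary part then factors, and where one of the three factors
    vanishes the real part can be evaluated. *)
Lemma zak_outer_neq0 {R : realType} (m : nat) (b x t : R) :
  sin t != 0 -> 0 <= x -> x < b - m%:R -> x < m.+1%:R - b ->
  ~ (zak_re m.+1 b x t = 0 /\ zak_im m.+1 b x t = 0).
Proof.
move=> s0 x0; rewrite -(addn1 m) natrD => hl hr [].
have m0 : (0 : R) <= m%:R by rewrite ler0n.
rewrite /zak_re /zak_im addn1 !big_ord_recr /=.
rewrite -/(zak_re m b x t) -/(zak_im m b x t).
rewrite zak_re_inner ?zak_im_inner; try by apply/andP; split; lra.
have -> : tent b (x - m.+1%:R) = 0.
  rewrite -addn1 natrD tent0 //.
  by rewrite ler0_norm; lra.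
have -> : tent b (x + m%:R) = b - m%:R - x.
  by rewrite tentE ger0_norm; lra.
have rE := sum_cos_odd m b t; have iE := sum_sin_odd m t.
set re := \sum_(j < m) _ * _ in rE *; set im := \sum_(j < m) _ in iE *.
rewrite cos_odd_mul sin_odd_mul.
have := cos2Dsin2 t; have := cos2Dsin2 (m%:R * t).
move: rE iE s0.
move: (sin t) (cos t) (sin (m%:R * t)) (cos (m%:R * t)) => s c S C.
set e := b - m%:R in hl *; have {}hr : x < 1 - e by rewrite /e; lra.
move=> rE iE s0 hC hc; set A := (X in X = 0 -> _).
set B := (X in _ -> X = 0 -> _).
move=> A0 B0.
have s2 : 0 < s ^+ 2 by rewrite exprn_even_gt0.
(* real part of the sum over - m <= k <= m, an interpolation of Fejer
   kernels *)
have E1 : (1 - e) * S ^+ 2 + e * (S * c + C * s) ^+ 2 - x * s ^+ 2 = 0.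
  transitivity (s ^+ 2 * (A * c - B * s)); last by rewrite A0 B0; ring.
  transitivity (c * (s ^+ 2 * re) - (2 * x - 1) * s ^+ 2 * (s * im)
    + s ^+ 2 * (e - x) * (C ^+ 2 - S ^+ 2) * (c ^+ 2 + s ^+ 2)); last first.
    by rewrite /A /B; ring.
  rewrite rE iE; apply/eqP; rewrite -subr_eq0; apply/eqP.
  transitivity ((S ^+ 2 * (1 - e) + s ^+ 2 * (e - x) * (C ^+ 2 - S ^+ 2))
                 * (1 - (c ^+ 2 + s ^+ 2))
                - s ^+ 2 * x * (1 - (C ^+ 2 + S ^+ 2))); first by ring.
  by rewrite hc hC; ring.
(* half of the imaginary part of the same sum *)
have E2 : x * (S * (S * c + C * s)) = 0.
  transitivity (2^-1 * (s * (A * s + B * c))); last by rewrite A0 B0; ring.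
  transitivity (2^-1 * (s ^+ 2 * re + (2 * x - 1) * c * (s * im)
    - (e - x) * 2 * S * C * s * (c ^+ 2 + s ^+ 2))); last first.
    by rewrite /A /B; field.
  by rewrite rE iE hc; field.
move/eqP: E2; rewrite !mulf_eq0 => /or3P[/eqP x00|/eqP S0|/eqP S1].
- move: E1 hl; rewrite x00 => E1 hl.
  have S0 : S ^+ 2 = 0 by have := sqr_ge0 S; have := sqr_ge0 (S * c + C * s); nra.
  have S1 : (S * c + C * s) ^+ 2 = 0 by have := sqr_ge0 (S * c + C * s); nra.
  move/eqP: S0; rewrite sqrf_eq0 => /eqP S0.
  move: S1 hC; rewrite S0 mul0r add0r expr0n addr0 exprMn => + hC.
  by rewrite hC mul1r => ?; lra.
- have C1 : C ^+ 2 = 1 by move: hC; rewrite S0 expr0n addr0.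
  by move: E1; rewrite S0 mul0r add0r expr0n /= exprMn C1 mul1r; nra.
(* sin ((m + 1) t) = 0 forces sin (m t) = +- sin t *)
- have S2 : S ^+ 2 = s ^+ 2.
    transitivity (S ^+ 2 * (c ^+ 2 + s ^+ 2)); first by rewrite hc mulr1.
    transitivity (s ^+ 2 * (C ^+ 2 + S ^+ 2)); last by rewrite hC mulr1.
    have -> : S ^+ 2 * (c ^+ 2 + s ^+ 2) = (S * c) ^+ 2 + S ^+ 2 * s ^+ 2 by ring.
    by rewrite (_ : S * c = - (C * s)); [ring | lra].
  by move: E1; rewrite S1 S2 expr0n /=; nra.
Qed.

(** * The two cases in terms of sines *)

Lemma sinDnatpi {R : realType} (n : nat) (u : R) :
  sin (pi * (u + n%:R)) = (-1) ^+ n * sin (pi * u).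
Proof. by rewrite mulrDr mulr_natr alternatingn //; exact: sinDpi. Qed.

Lemma sin_pi_gt0 {R : realType} (u : R) : 0 < u < 1 -> 0 < sin (pi * u).
Proof.
move=> /andP[u0 u1]; apply: sin_gt0_pi.
by rewrite mulr_gt0 ?pi_gt0 // gtr_pMr ?pi_gt0.
Qed.

Lemma sin_pi_eq0 {R : realType} (u : R) :
  0 <= u -> (sin (pi * u) == 0) = (u \is a Num.int).
Proof.
move=> u0; rewrite intrEge0 //; apply/idP/idP => [|/natrP[k ->]]; last first.
  by rewrite -[k%:R]add0r sinDnatpi mulr0 sin0 mulr0.
have := truncn_itv u0; set n := Num.truncn u => /andP[nu un].
rewrite -[in sin _](subrK n%:R u) sinDnatpi mulf_eq0 signr_eq0 /=.
have [-> _|nz] := eqVneq u n%:R; first exact: natr_nat.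
have nu' : n%:R < u by rewrite lt_neqAle eq_sym nz.
rewrite gt_eqF //; apply: sin_pi_gt0.
by move: un; rewrite -addn1 natrD; lra.
Qed.

(** For 0 <= gam < 1 the residue of the numerator is the numerator itself, so
    that excluding k = 0 modulo n amounts to excluding gam = 0. *)
Lemma nth_fractionP {R : realType} (n : nat) (gam : R) :
  (0 < n)%N -> 0 <= gam < 1 ->
  (exists2 k : int, (k != 0 %[mod n%:Z])%Z & gam = k%:~R / n%:Z%:~R) <->
  gam != 0 /\ sin (n%:R * (pi * gam)) = 0.
Proof.
move=> n0 /andP[g0 g1].
have nR : (0 : R) < n%:R by rewrite ltr0n.
have ng0 : 0 <= n%:R * gam by rewrite mulr_ge0 // ltW.
rewrite mulrCA; split=> [[k kn gE]|[gn0 /eqP]].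
- have kE : n%:R * gam = k%:~R by rewrite gE mulrCA divff ?mulr1 ?gt_eqF.
  split; last by apply/eqP; rewrite sin_pi_eq0 // kE intr_int.
  apply: contraNneq kn => gz; move: kE.
  by rewrite gz mulr0 => /esym/eqP; rewrite intr_eq0 => /eqP ->.
- rewrite sin_pi_eq0 // => /intrP[k kE].
  exists k; last by rewrite -kE -pmulrn mulrAC divff ?gt_eqF ?mul1r.
  have gp : 0 < gam by rewrite lt_neqAle eq_sym gn0.
  have k0 : 0 < k by rewrite -(ltr0z R) -kE mulr_gt0.
  have kn : k < n%:Z by rewrite -(ltr_int R) -kE -pmulrn gtr_pMr.
  by rewrite mod0z modz_small ?kn ?andbT ?gt_eqF ?ltW.
Qed.

Lemma cot_eqE {R : realType} (n : nat) (a t : R) :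
  sin t != 0 -> sin (n%:R * t) != 0 ->
  (2^-1 * cot t + a * cot (n%:R * t) = 0 <->
   2 * a * cos (n%:R * t) * sin t + sin (n%:R * t) * cos t = 0).
Proof.
move=> s0 S0; rewrite /cot.
have -> : 2^-1 * (cos t / sin t) + a * (cos (n%:R * t) / sin (n%:R * t)) =
  (2 * a * cos (n%:R * t) * sin t + sin (n%:R * t) * cos t)
    / (2 * sin t * sin (n%:R * t)) by field; rewrite s0 S0.
split=> [/eqP|->]; last by rewrite mul0r.
rewrite mulf_eq0 invr_eq0 => /orP[/eqP//|].
by rewrite !mulf_eq0 (negPf s0) (negPf S0) pnatr_eq0.
Qed.

(** * Zeros of the Zak transform *)

Lemma zakQ2_outer_neq0 {R : realType} (m : nat) (b x gam : R) :
  0 < gam < 1 -> m%:R <= b < m.+1%:R -> 0 <= x < 1 ->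
  x < Num.min (b - m%:R) (m.+1%:R - b) \/
    1 - Num.min (b - m%:R) (m.+1%:R - b) < x -> 0 < b ->
  zakQ2 b^-1 x gam <> 0.
Proof.
move=> g01 /andP[mb bm] /andP[x0 x1] hx b0.
have s0 : sin (pi * gam) != 0 by rewrite gt_eqF // sin_pi_gt0.
have bm' := bm; rewrite -addn1 natrD in bm'.
rewrite (zakQ2_eq0 m.+1) //; last 2 first.
- by rewrite -(addn1 m) natrD; lra.
- by rewrite -(addn1 m.+1) natrD; lra.
case: hx => [|]; rewrite ?ltrBlDr ?[x + _]addrC -?ltrBlDr lt_min => /andP[h1 h2].
  exact: zak_outer_neq0.
rewrite -(opprK (zak_im _ _ _ _)) -zak_im_reflect -zak_re_reflect => -[re0 /eqP].
rewrite oppr_eq0 => /eqP im0.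
by apply: (zak_outer_neq0 m b (1 - x) (pi * gam)) => //; lra.
Qed.

Lemma fround_bound {R : realType} (b : R) : - 2^-1 <= fround b < 2^-1.
Proof.
have := floor_itv (b + 2^-1); rewrite /fround /nround intrD => /andP[? ?].
by apply/andP; split; lra.
Qed.

Theorem theorem2 (R : realType) (b : R) (hb : 3 / 2 <= b) :
  let N : int := nround b in
  let eps : R := fround b in
  let Z : R -> R -> R[i] := zakQ2 b^-1 in
  let caseI (gam : R) :=
    exists2 k : int, (k != 0 %[mod N])%Z & gam = k%:~R / N%:~R in
  let caseII (gam : R) :=
    N%:~R * gam \isn't a Num.int /\
    2^-1 * cot (pi * gam) + (b - N%:~R) * cot (N%:~R * pi * gam) = 0 in
  forall gam : R, 0 <= gam < 1 ->
  [/\ forall x : R, 0 <= x < 1 -> Z x gam = 0 ->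
        `|eps| <= x <= 1 - `|eps| /\ (caseI gam \/ caseII gam),
      caseI gam ->
        forall y : R, `|eps| <= y <= 1 - `|eps| -> Z y gam = 0
    & caseII gam ->
        forall x : R, 0 <= x < 1 -> (Z x gam = 0 <-> x = 2^-1)].
Proof.
move=> N eps Z caseI caseII gam hgam.
have /andP[g0 g1] := hgam.
have := fround_bound b; rewrite -/eps => /andP[e1 e2].
have [n NE n1] : exists2 n : nat, N = n%:Z & (1 < n)%N.
  have : (2%:Z <= N) by rewrite /N /nround floor_ge_int -pmulrn; lra.
  by move=> h; exists `|N|%N; lia.
have bE : b = n%:R + eps by rewrite /eps /fround -/N NE addrC subrK.
have b0 : 0 < b by lra.
have n2 : (2 : R) <= n%:R by rewrite ler_nat.
have caseIE : caseI gam <-> gam != 0 /\ sin (n%:R * (pi * gam)) = 0.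
  by rewrite /caseI NE; apply: nth_fractionP => //; lia.
have epsE : eps = b - n%:R by rewrite bE addrC addKr.
have [gz|gnz] := eqVneq gam 0.
  have Zn0 (x : R) : 0 <= x < 1 -> Z x gam <> 0.
    move=> /andP[x0 x1]; rewrite /Z (zakQ2_eq0 n.+1) //; last 2 first.
    - by rewrite -(addn1 n) natrD; lra.
    - by rewrite -(addn1 n.+1) -(addn1 n) !natrD; lra.
    rewrite gz mulr0 => -[re0 _].
    by have := zak_re_gt0_at0 n.+1 b x isT; rewrite re0 ger0_norm // ltxx; lra.
  split=> [x x01 /(Zn0 _ x01)//|/caseIE[]|]; first by rewrite gz eqxx.
  by case; rewrite gz mulr0 rpred0.
have gp : 0 < gam < 1 by rewrite lt_neqAle eq_sym gnz g0.
have s0 : sin (pi * gam) != 0 by rewrite gt_eqF // sin_pi_gt0.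
have caseIIE : caseII gam <-> sin (n%:R * (pi * gam)) != 0 /\
    2 * (b - n%:R) * cos (n%:R * (pi * gam)) * sin (pi * gam) +
    sin (n%:R * (pi * gam)) * cos (pi * gam) = 0.
  rewrite /caseII NE -pmulrn -mulrA -sin_pi_eq0; last by rewrite mulr_ge0.
  rewrite mulrCA.
  split=> -[S0 h]; split=> //; exact/(cot_eqE n (b - n%:R) _ s0 S0).
have inner (x : R) : `|eps| <= x <= 1 - `|eps| ->
    (Z x gam = 0 <-> sin (n%:R * (pi * gam)) = 0 \/
     2 * (b - n%:R) * cos (n%:R * (pi * gam)) * sin (pi * gam) +
     sin (n%:R * (pi * gam)) * cos (pi * gam) = 0 /\ x = 2^-1).
  move=> /andP[h1 h2].
  have := ler_norm eps; have := ler_norm (- eps); rewrite normrN => h3 h4.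
  rewrite /Z (zakQ2_eq0 n) //; last 2 first.
  - by lra.
  - by rewrite -(addn1 n) natrD; lra.
  by apply: zak_inner_eq0 => //; apply/andP; split; lra.
have outer (x : R) : 0 <= x < 1 -> Z x gam = 0 -> `|eps| <= x <= 1 - `|eps|.
  move=> x01 Z0.
  (* m is the floor of b *)
  pose m := if 0 <= eps then n else n.-1.
  have mE : m.+1%:R = m%:R + 1 :> R by rewrite -addn1 natrD.
  have mR : m%:R = if 0 <= eps then n%:R else n%:R - 1 :> R.
    rewrite /m; case: ifP => // _.
    by rewrite -[in RHS](prednK (ltnW n1)) -addn1 natrD addrK.
  have epsm : `|eps| = Num.min (b - m%:R) (m.+1%:R - b).
    rewrite mE mR; case: ger0P => h.
      by rewrite min_l; lra.
    by rewrite min_r; lra.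
  rewrite !leNgt -negb_or; apply/negP => h.
  apply: (zakQ2_outer_neq0 m b x gam) Z0 => //.
  - by rewrite mE mR; case: ifP => h'; lra.
  - by rewrite -epsm; apply/orP.
have half : `|eps| <= 2^-1 <= 1 - `|eps|.
  have : `|eps| <= 2^-1 by rewrite ler_norml; lra.
  by lra.
split.
- move=> x x01 Z0; have xe := outer _ x01 Z0; split=> //.
  have [S0|Sn0] := eqVneq (sin (n%:R * (pi * gam))) 0.
    by left; apply/caseIE.
  right; apply/caseIIE; split=> //.
  by move/(inner _ xe): Z0 => [S0|[]//]; rewrite S0 eqxx in Sn0.
- by move=> /caseIE[_ S0] y ye; apply/(inner _ ye); left.
- move=> /caseIIE[Sn0 h] x x01; split=> [Z0|->].
    move/(inner _ (outer _ x01 Z0)): Z0 => [S0|[]//].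
    by rewrite S0 eqxx in Sn0.
  by apply/(inner _ half); right.
Qed.
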